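(* Let $p$ be an odd prime, $q=p^3$, $\mathbb{F}_q=\{c_0,c_1,\ldots,c_{q-1}\}$, and let $a,b\in\mathfrak{S}_q$ and $G=\langle a,b\rangle$ be the permutations and the group described in the context. Let $f\in\mathbb{F}_q[X_1,X_2]$ be the permutation group polynomial corresponding to $G$ whose permutation polynomial tuple is $\underline{\beta}_f=(\beta_0,\beta_1,\ldots,\beta_{q-1})$, where $\beta_t=a^kb^{ip+j}$ for $t=((i+jk)\bmod p)\,p+jp^2+k$ with $i,j,k\in\{0,1,\ldots,p-1\}$. Define $h$ on $\mathbb{F}_q$ by $$h\left(c_{((i+jk)\bmod p)p+jp^2+k}\right):=a^{k}b^{ip+j}\left(c_{((i+jk)\bmod p)p+jp^2+k}\right),\qquad i,j,k\in\{0,1,\ldots,p-1\}.$$ Then the bivariate local permutation polynomial $g(X_1,X_2)$ corresponding to the permutation polynomial tuple $(h\beta_0,h\beta_1,\ldots,h\beta_{q-1})$ is a companion of $f$.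
   Context: $\mathfrak{S}_q$ is the symmetric group on $\mathbb{F}_q$; permutations are composed right to left, $(xy)(c)=x(y(c))$. The enumeration $c_0,\ldots,c_{q-1}$ is fixed. The permutations are $$a=(c_{0},c_{1},\ldots,c_{p^2-1})(c_{p^2},\ldots,c_{2p^2-1})\cdots (c_{p^2(p-1)},\ldots,c_{p^3-1}),\qquad b=b_{0}\,b_{1}^{1+p}\,b_2^{1+2p}\cdots b_{p-1}^{1+(p-1)p},$$ where $b_{k}=(c_{k},c_{p^2+k},\ldots,c_{(p-1)p^2+k},\;c_{p+k},c_{p+p^2+k},\ldots,c_{p+(p-1)p^2+k},\;\ldots,\;c_{(p-1)p+k},c_{(p-1)p+p^2+k},\ldots,c_{(p-1)p+(p-1)p^2+k})$ is a $p^2$-cycle (entries $c_{jp+ip^2+k}$, with $i=0,\ldots,p-1$ running first for $j=0$, then $j=1$, etc.). The group $G=\langle a,b\rangle$ has order $q$ and no non-identity element of $G$ has a fixed point. Functions $\mathbb{F}_q^2\to\mathbb{F}_q$ are identified with polynomials in $\mathbb{F}_q[X_1,X_2]$ of degree less than $q$ in each variable. A bivariate polynomial $f$ is a local permutation polynomial (LPP) if for every $c\in\mathbb{F}_q$ both $x\mapsto f(x,c)$ and $x\mapsto f(c,x)$ are bijections of $\mathbb{F}_q$. Bivariate LPPs are in bijection with permutation polynomial tuples, i.e. tuples $\underline{\beta}_f=(\beta_0,\ldots,\beta_{q-1})\in\mathfrak{S}_q^q$ such that $\beta_i\beta_j^{-1}$ has no fixed point for $i\ne j$, via $f(x,\beta_i(x))=c_i$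 for all $x\in\mathbb{F}_q$ and all $i$. An LPP is a permutation group polynomial if the entries of its tuple form a subgroup of $\mathfrak{S}_q$, and it then corresponds to that subgroup. Two bivariate LPPs $f,g$ are companions of each other if for all $(u,v)\in\mathbb{F}_q^2$ the system $f(x_1,x_2)=u$, $g(x_1,x_2)=v$ has a unique solution $(x_1,x_2)\in\mathbb{F}_q^2$. *)

(* Defs.v *)
From mathcomp Require Import all_boot all_fingroup all_algebra.
From mathcomp Require Import mpoly.

Set Implicit Arguments.
Unset Strict Implicit.
Unset Printing Implicit Defensive.

Import GRing.Theory.

(* Right-to-left composition: comp_perm x y maps c to x (y c).  The group law of
   {perm T} composes left to right; powers, inverses and subgroups are the
   same for both conventions. *)
Definition comp_perm (T : finType) (x y : {perm T}) : {perm T} := (y * x)%g.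

(* The cycle (s_0, s_1, ...); undup makes the definition total and does nothing
   on duplicate-free sequences. *)
Definition cycle_perm (T : finType) (s : seq T) : {perm T} :=
  perm (can_inj (prev_next (undup_uniq s))).

Section Generators.

(* The enumeration c_0, c_1, ... of F is the sequence c, with c_n = c`_n. *)
Variables (p : nat) (F : finFieldType) (c : seq F).

Local Open Scope ring_scope.

Definition cycle_a (m : nat) : {perm F} :=
  cycle_perm [seq c`_(m * p ^ 2 + n) | n <- iota 0 (p ^ 2)].

Definition cycle_b (k : nat) : {perm F} :=
  cycle_perm [seq c`_(j * p + i * p ^ 2 + k) | j <- iota 0 p, i <- iota 0 p].

(* In both products the cycles are disjoint, so the order is irrelevant. *)
Definition perm_a : {perm F} := (\prod_(m < p) cycle_a m)%g.

Definition perm_b : {perm F} := (\prod_(k < p) cycle_b k ^+ (1 + k * p))%g.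

Definition group_G : {group {perm F}} := <<[set perm_a; perm_b]>>%G.

Definition elt (i j k : nat) : {perm F} :=
  comp_perm (perm_a ^+ k)%g (perm_b ^+ (i * p + j))%g.

Definition idx (i j k : nat) : nat :=
  ((i + j * k) %% p * p + j * p ^ 2 + k)%N.

End Generators.

Section LocalPermutationPolynomials.

Variables (F : finFieldType) (c : seq F).

Local Open Scope ring_scope.

Definition ev2 (f : {mpoly F[2]}) (x y : F) : F := f.@[tnth [tuple x; y]].

Definition reduced (f : {mpoly F[2]}) : Prop :=
  forall m, m \in msupp f -> forall i : 'I_2, (m i < #|F|)%N.

Definition is_lpp (f : {mpoly F[2]}) : Prop :=
  forall z : F, bijective (fun x => ev2 f x z) /\ bijective (fun x => ev2 f z x).

Definition pp_tuple (beta : 'I_#|F| -> {perm F}) : Prop :=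
  forall i j, i != j -> forall x, comp_perm (beta i) (beta j)^-1%g x != x.

Definition lpp_of_tuple (beta : 'I_#|F| -> {perm F}) (f : {mpoly F[2]}) : Prop :=
  [/\ reduced f, is_lpp f, pp_tuple beta
    & forall (i : 'I_#|F|) (x : F), ev2 f x (beta i x) = c`_i].

Definition perm_group_poly (f : {mpoly F[2]}) (G : {group {perm F}}) : Prop :=
  exists2 beta, lpp_of_tuple beta f & [set beta i | i : 'I_#|F|] = G :> {set _}.

Definition companions (f g : {mpoly F[2]}) : Prop :=
  forall u v : F, exists! x : F * F, ev2 f x.1 x.2 = u /\ ev2 g x.1 x.2 = v.

End LocalPermutationPolynomials.

(* Main.v *)
(** In coordinates n = x p^2 + y p + k, extended by carries to a map pt from
    N^3 onto F, the generators act by the carry-free formulas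
    a : (x, y, k) -> (x, y, k + 1) and b : (x, y, k) -> (x + 1, y + k, k).
    Hence a^k b^(ip+j) sends (x, y, l) to (x + j, y + i + j l, l + k), so G
    consists of exactly these p^3 elements and is regular on F.  The function h
    becomes coordinatewise doubling, a bijection as p is odd.  The equations
    f = c_s, g = c_t say that beta_s beta_t^-1 and h agree at beta_t(x_1); at
    every point z the element of G indexed by z is the only one agreeing with
    h, so each element of G agrees with h exactly once. *)
Require Import Defs.
From mathcomp Require Import all_boot all_fingroup all_algebra.
From mathcomp Require Import mpoly zify.

Set Implicit Arguments.
Unset Strict Implicit.
Unset Printing Implicit Defensive.

Import GRing.Theory.

Local Open Scope ring_scope.

(** * Reduced bivariate polynomials and functions on the plane *)

Section Interpolation.

Variable F : finFieldType.

(** A polynomial with at most [#|F|] coefficients that vanishes on all of [F] has more roots than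
    its degree allows. *)
Lemma sum_pow_eq0 (a : 'I_#|F| -> F) :
  (forall x, \sum_i a i * x ^+ i = 0) -> forall i, a i = 0.
Proof.
move=> a0 i; pose P := \poly_(j < #|F|) oapp a 0 (insub j).
suff P0 : P = 0.
  by have := coef_poly #|F| (fun j => oapp a 0 (insub j)) i;
    rewrite -/P P0 coef0 ltn_ord valK.
apply: (@roots_geq_poly_eq0 F P (enum F)); last by rewrite -cardE size_poly.
  apply/allP => x _; rewrite rootE horner_poly; apply/eqP.
  by rewrite -[RHS](a0 x); apply: eq_bigr => j _; rewrite valK.
exact: enum_uniq.
Qed.

Definition mnm2 (ij : 'I_#|F| * 'I_#|F|) : 'X_{1..2} :=
  [multinom [tuple ij.1 : nat; ij.2 : nat]].

Definition mpoly_of (k : {ffun 'I_#|F| * 'I_#|F| -> F}) : {mpoly F[2]} :=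
  \sum_ij k ij *: 'X_[mnm2 ij].

Lemma mnm2_inj : injective mnm2.
Proof.
move=> [i j] [i' j'] /mnmP e.
have := e ord0; have := e (lift ord0 ord0).
by rewrite !multinomE !(tnth_nth 0%N) => /= /ord_inj -> /ord_inj ->.
Qed.

Lemma mcoeff_mpoly_of k ij : (mpoly_of k)@_(mnm2 ij) = k ij.
Proof.
rewrite /mpoly_of raddf_sum (bigD1 ij) //= mcoeffZ mcoeffX eqxx mulr1.
rewrite big1 ?addr0 // => ij' ne; rewrite mcoeffZ mcoeffX.
by rewrite (inj_eq mnm2_inj) (negPf ne) mulr0.
Qed.

Lemma reduced_mpoly_of k : reduced (mpoly_of k).
Proof.
move=> m; rewrite mcoeff_msupp => m_supp.
suff [ij ->] : exists ij, m = mnm2 ij.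
  by move=> i; rewrite multinomE (tnth_nth 0%N); case: i => [[|[]]] //= _; apply: ltn_ord.
case: (pickP [pred ij | m == mnm2 ij]) => [ij /eqP|mN]; first by exists ij.
case/eqP: m_supp; rewrite /mpoly_of raddf_sum big1 // => ij _.
by rewrite /= mcoeffZ mcoeffX eq_sym [_ == _]mN mulr0.
Qed.

Lemma reduced_mpolyE f : reduced f -> f = mpoly_of [ffun ij => f@_(mnm2 ij)].
Proof.
move=> f_red; have mE (m : 'X_{1..2}) : (forall i : 'I_2, (m i < #|F|)%N) -> exists ij, m = mnm2 ij.
  move=> m_lt; exists (Ordinal (m_lt ord0), Ordinal (m_lt (lift ord0 ord0))).
  apply/mnmP => i; rewrite multinomE.
  by rewrite (tnth_nth 0%N); case: i => [[|[]]] //= i_lt; congr (m _); apply: ord_inj.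
apply/mpolyP => m; case: (boolP (m \in msupp f)) => [/f_red/mE[ij ->]|m_nf].
  by rewrite mcoeff_mpoly_of ffunE.
case: (boolP (m \in msupp (mpoly_of [ffun ij => f@_(mnm2 ij)]))) => [m_f|].
  by have [ij ->] := mE _ (reduced_mpoly_of m_f); rewrite mcoeff_mpoly_of ffunE.
by move: m_nf; rewrite !mcoeff_msupp !negbK => /eqP-> /eqP->.
Qed.

Definition eval_fun (f : {mpoly F[2]}) : {ffun F * F -> F} :=
  [ffun xy => ev2 f xy.1 xy.2].

Lemma ev2_mpoly_of k x y :
  ev2 (mpoly_of k) x y = \sum_i (\sum_j k (i, j) * y ^+ j) * x ^+ i.
Proof.
rewrite /ev2 /mpoly_of raddf_sum /= (eq_bigr (fun i => \sum_j k (i, j) * y ^+ j * x ^+ i)).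
  rewrite pair_big; apply: eq_bigr => -[i j] _ /=.
  rewrite mevalZ mevalX !big_ord_recl big_ord0 mulr1 /mnm2 !multinomE.
  by rewrite !(tnth_nth 0) /= -mulrA [y ^+ _ * _]mulrC.
by move=> i _; rewrite mulr_suml.
Qed.

(** The univariate vanishing lemma is applied to one variable at a time: the difference is a
    polynomial in x whose coefficients are polynomials in y. *)
Lemma eval_mpoly_of_inj : injective (eval_fun \o mpoly_of).
Proof.
move=> k k' /ffunP e; apply/ffunP => -[i0 j0].
suff dk0 : forall i j, k (i, j) - k' (i, j) = 0 by apply/eqP; rewrite -subr_eq0 dk0.
move=> i; apply: sum_pow_eq0 => y; move: i; apply: sum_pow_eq0 => x.
apply: etrans (_ : ev2 (mpoly_of k) x y - ev2 (mpoly_of k') x y = 0); last first.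
  by have := e (x, y); rewrite !ffunE /= => ->; rewrite subrr.
rewrite !ev2_mpoly_of -sumrB; apply: eq_bigr => i _; rewrite -mulrBl -sumrB.
by congr (_ * _); apply: eq_bigr => j _; rewrite mulrBl.
Qed.

(** Counting replaces an explicit Lagrange formula: coefficient arrays and functions on the plane
    are equinumerous, so injective evaluation is onto. *)
Lemma interpolation (v : F -> F -> F) :
  exists2 f, reduced f & forall x y, ev2 f x y = v x y.
Proof.
have [|g _ eg] := inj_card_bij eval_mpoly_of_inj.
  by rewrite !card_ffun !card_prod !card_ord.
exists (mpoly_of (g [ffun xy => v xy.1 xy.2])); first exact: reduced_mpoly_of.
by move=> x y; have /ffunP/(_ (x, y)) := eg [ffun xy => v xy.1 xy.2]; rewrite !ffunE.
Qed.

Lemma reduced_ev2_inj (f g : {mpoly F[2]}) :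
  reduced f -> reduced g -> (forall x y, ev2 f x y = ev2 g x y) -> f = g.
Proof.
move=> /reduced_mpolyE-> /reduced_mpolyE-> e; congr mpoly_of.
by apply: eval_mpoly_of_inj; apply/ffunP => xy; rewrite !ffunE e.
Qed.

End Interpolation.

(** * From permutation polynomial tuples to local permutation polynomials *)

Section TupleToPolynomial.

Variables (F : finFieldType) (c : seq F).
Hypothesis c_enum : perm_eq c (enum F).

Lemma size_enumeration : size c = #|F|.
Proof. by rewrite (perm_size c_enum) cardE. Qed.

Lemma enumeration_uniq : uniq c.
Proof. by rewrite (perm_uniq c_enum) enum_uniq. Qed.

Lemma nth_enumeration_inj n m :
  (n < #|F|)%N -> (m < #|F|)%N -> c`_n = c`_m -> n = m.
Proof.
rewrite -size_enumeration => n_lt m_lt /eqP.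
by rewrite nth_uniq ?enumeration_uniq // => /eqP.
Qed.

(** The Latin square form of the condition: a fixed point of beta_i beta_j^-1 is the common value of
    beta_i and beta_j at its preimage under beta_j. *)
Lemma pp_tupleP (beta : 'I_#|F| -> {perm F}) :
  pp_tuple beta <-> forall x i j, beta i x = beta j x -> i = j.
Proof.
split=> [bP x i j e | b_inj i j ne x].
  apply: contraTeq isT => /bP/(_ (beta j x)).
  by rewrite permM permK e eqxx.
apply: contra_neq ne => e; apply: (b_inj ((beta j)^-1%g x)).
by rewrite permKV -[RHS]e permM.
Qed.

(** For fixed x the map i -> beta_i(x) is injective between sets of equal size, so each y is
    beta_i(x) for exactly one i; interpolating (x, y) -> c_i gives the polynomial. *)
Lemma lpp_of_tuple_exists (beta : 'I_#|F| -> {perm F}) :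
  pp_tuple beta -> exists f, unique (lpp_of_tuple c beta) f.
Proof.
move=> bP; have b_inj := iffLR (pp_tupleP _) bP.
have b_surj x y : {i | beta i x == y}.
  apply: sigW.
  have [|g _ gK] := @inj_card_bij _ _ (fun i => beta i x) (b_inj x).
    by rewrite card_ord.
  by exists (g y); apply/eqP.
have [f f_red fE] := interpolation (fun x y => c`_(sval (b_surj x y))).
have fb i x : ev2 f x (beta i x) = c`_i.
  by rewrite fE; case: (b_surj _ _) => j /= /eqP/b_inj ->.
exists f; split=> [|f' [f'_red _ _ f'b]]; last first.
  apply: reduced_ev2_inj => // x y.
  by have [i /eqP<-] := b_surj x y; rewrite fb f'b.
split=> // z; split; apply: injF_bij => x y.
  (* Equal values at (x, z) and (y, z) mean that a single beta_i sends both x and y to z. *)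
  have [[i /eqP ix] [j /eqP jy]] := (b_surj x z, b_surj y z).
  rewrite -{1}ix -{1}jy !fb => /nth_enumeration_inj/ord_inj ij.
  by apply: (@perm_inj _ (beta i)); rewrite ix ij.
have [[i /eqP<-] [j /eqP<-]] := (b_surj z x, b_surj z y).
by rewrite !fb => /nth_enumeration_inj/ord_inj->.
Qed.

End TupleToPolynomial.

(** * Evaluation of cycles and of products of disjoint permutations *)

Section Cycles.

Variables (T : finType) (N : nat) (d : nat -> T).
Hypotheses (N_gt0 : (0 < N)%N) (d_mod : forall n, d (n %% N) = d n).
Hypothesis d_inj : forall n m, (n < N)%N -> (m < N)%N -> d n = d m -> n = m.

Lemma cycle_perm_nth n : cycle_perm [seq d i | i <- iota 0 N] (d n) = d n.+1.
Proof.
have Us : uniq [seq d i | i <- iota 0 N].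
  rewrite map_inj_in_uniq ?iota_uniq // => i j.
  by rewrite !mem_iota !add0n; apply: d_inj.
rewrite permE undup_id // -(d_mod n) -(d_mod n.+1) -addn1 -modnDml addn1.
have := ltn_pmod n N_gt0; move: (n %% N)%N => {}n n_lt.
have dn : d n = nth (d 0%N) [seq d i | i <- iota 0 N] n.
  by rewrite (nth_map 0%N) ?size_iota ?nth_iota.
rewrite next_nth map_f ?mem_iota //.
rewrite {2}dn index_uniq ?size_map ?size_iota //.
case: N N_gt0 d_mod n_lt {Us dn} => // M _ dM; rewrite /= ltnS leq_eqVlt.
case/predU1P => [->|n_lt].
  (* At the last index the lookup in the tail falls back on its default, the head [d 0], which
     closes the cycle. *)
  by rewrite nth_default ?modnn // size_map size_iota.
by rewrite modn_small // (nth_map 0%N) ?size_iota // nth_iota.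
Qed.

Lemma cycle_perm_out z : (forall n, z <> d n) ->
  cycle_perm [seq d i | i <- iota 0 N] z = z.
Proof.
move=> zN; rewrite permE next_nth mem_undup ifN //.
by apply/mapP => -[n _ /zN].
Qed.

End Cycles.

Lemma prod_perm_fix (T : finType) (I : eqType) (r : seq I) (s : I -> {perm T}) z :
  (forall i, i \in r -> s i z = z) -> (\prod_(i <- r) s i)%g z = z.
Proof.
elim: r => [|i r IHr] sz; first by rewrite big_nil perm1.
rewrite big_cons permM sz ?mem_head // IHr // => j jr.
by rewrite sz // inE jr orbT.
Qed.

(** Disjointness enters only locally: the other factors need to fix just [z] and its image,
    whichever side of [i0] they stand on. *)
Lemma prod_perm_single (T : finType) n (s : 'I_n -> {perm T}) i0 z :
  (forall i, i != i0 -> s i z = z) ->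
  (forall i, i != i0 -> s i (s i0 z) = s i0 z) ->
  (\prod_i s i)%g z = s i0 z.
Proof.
move=> sz ssz; have := index_enum_uniq 'I_n; have := mem_index_enum i0.
elim: (index_enum _) => // i r IHr; rewrite inE big_cons permM /=.
have [<- _ /andP[iNr _]|ne /= i0r /andP[_ Ur]] := eqVneq i0 i; last first.
  by rewrite sz ?(eq_sym i) // IHr.
rewrite prod_perm_fix // => j jr; apply: ssz.
by apply: contraNneq iNr => <-.
Qed.

(** This flattens the doubly indexed list that defines b_k, so that the lemmas on singly indexed
    cycles apply to it. *)
Lemma map_iota_mul (T : Type) (g : nat -> nat -> T) n p : (0 < p)%N ->
  [seq g j i | j <- iota 0 n, i <- iota 0 p] =
  [seq g (s %/ p)%N (s %% p)%N | s <- iota 0 (n * p)].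
Proof.
move=> p_gt0; elim: n => // n IHn.
rewrite -addn1 iotaD allpairs_cat IHn mulnDl mul1n iotaD map_cat /= cats0.
congr (_ ++ _); have -> : iota (0 + n * p) p = [seq (n * p + i)%N | i <- iota 0 p].
  by rewrite -iotaDl addn0.
rewrite -map_comp.
apply/eq_in_map => i; rewrite mem_iota /= => i_lt.
by rewrite /= divnMDl // modnMDl divn_small // modn_small // addn0.
Qed.

(** * Carry coordinates on the field *)

Section Coordinates.

Variables (p : nat) (F : finFieldType) (c : seq F).
Hypotheses (p_gt0 : (0 < p)%N) (cardF : #|F| = (p ^ 3)%N).
Hypothesis c_enum : perm_eq c (enum F).

(* Carries from x and from k go into y, so that pt (x + p) y k = pt x (y + 1) k
   = pt x y (k + p). *)
Definition pt (x y k : nat) : F :=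
  c`_(x %% p * p ^ 2 + (y + x %/ p + k %/ p) %% p * p + k %% p).

Local Open Scope nat_scope.

Lemma pt_carry_x x y k n : pt (n * p + x) y k = pt x (y + n) k.
Proof. by rewrite /pt modnMDl divnMDl // addnA. Qed.

Lemma pt_carry_k x y k n : pt x y (n * p + k) = pt x (y + n) k.
Proof. by rewrite /pt modnMDl divnMDl // addnA (addnAC y). Qed.

Lemma pt_mod_y x y y' k : y = y' %[mod p] -> pt x y k = pt x y' k.
Proof. by move=> e; rewrite /pt -!addnA -modnDml e modnDml. Qed.

Lemma pt_small x y k : x < p -> y < p -> k < p ->
  pt x y k = (c`_(x * p ^ 2 + y * p + k))%R.
Proof.
by move=> xp yp kp; rewrite /pt !(divn_small, modn_small) ?addn0 ?modn_small.
Qed.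

Lemma digits_lt x y k : x < p -> y < p -> k < p -> x * p ^ 2 + y * p + k < p ^ 3.
Proof.
move=> xp yp kp; apply: (@leq_trans ((x * p + y).+1 * p)).
  by rewrite -mulnn mulnA -mulnDl mulSn [p + _]addnC ltn_add2l.
rewrite (expnS p 2) mulnC leq_pmul2l // -mulnn.
by apply: (@leq_trans (x.+1 * p)); rewrite ?leq_pmul2r // mulSn addnC ltn_add2r.
Qed.

Lemma digits_inj x y k x' y' k' :
  y < p -> k < p -> y' < p -> k' < p ->
  x * p ^ 2 + y * p + k = x' * p ^ 2 + y' * p + k' -> [/\ x = x', y = y' & k = k'].
Proof.
move=> yp kp yp' kp'; rewrite -mulnn !mulnA -!mulnDl => e.
have := congr1 (modn^~ p) e; rewrite /= !modnMDl !modn_small // => kk.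
have := congr1 (divn^~ p) e; rewrite /= !divnMDl // !divn_small // !addn0 => {}e.
have := congr1 (modn^~ p) e; rewrite /= !modnMDl !modn_small // => yy.
by have := congr1 (divn^~ p) e; rewrite /= !divnMDl // !divn_small // !addn0.
Qed.

Lemma pt_inj x y k x' y' k' : pt x y k = pt x' y' k' ->
  [/\ x = x' %[mod p], k = k' %[mod p]
    & y + x %/ p + k %/ p = y' + x' %/ p + k' %/ p %[mod p]].
Proof.
have mp n : n %% p < p by rewrite ltn_pmod.
move/(nth_enumeration_inj c_enum); rewrite cardF => e.
by have [] := digits_inj (mp _) (mp _) (mp _) (mp _) (e (digits_lt _ _ _) (digits_lt _ _ _)).
Qed.

Lemma pt_surj z : exists x y k, [/\ x < p, y < p, k < p & z = pt x y k].
Proof.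
have z_c : z \in c by rewrite (perm_mem c_enum) mem_enum.
have := z_c; rewrite -index_mem (size_enumeration c_enum) cardF.
move en : (index z c) => n n_lt; have mp m : m %% p < p by rewrite ltn_pmod.
exists (n %/ p %/ p), (n %/ p %% p), (n %% p).
have n2p : n %/ p %/ p < p by rewrite -divnMA ltn_divLR ?muln_gt0 ?p_gt0 // -!expnS.
split=> //; rewrite pt_small // -mulnn mulnA -mulnDl -!divn_eq -en.
by rewrite nth_index.
Qed.

Lemma perm_ptP (s t : {perm F}) :
  (forall x y k, s (pt x y k) = t (pt x y k)) -> s = t.
Proof. by move=> st; apply/permP => z; have [x [y [k [_ _ _ ->]]]] := pt_surj z. Qed.

(** * The generators in coordinates *)

Lemma cycle_aE m : m < p ->
  cycle_a p c m = cycle_perm [seq pt m 0 n | n <- iota 0 (p ^ 2)].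
Proof.
move=> mp; congr cycle_perm; apply/eq_in_map => n; rewrite mem_iota /= => n_lt.
rewrite /pt (modn_small mp) (divn_small mp) !add0n (@modn_small (n %/ p)).
  by rewrite -addnA -divn_eq.
by rewrite ltn_divLR // mulnn.
Qed.

(** Entry n of b_k has x-digit n mod p and y-digit n / p. This is how [pt] carries from x into y, so
    the cycle is a line along x. *)
Lemma cycle_bE k : k < p ->
  cycle_b p c k = cycle_perm [seq pt n 0 k | n <- iota 0 (p ^ 2)].
Proof.
move=> kp; congr cycle_perm.
rewrite (map_iota_mul (fun j i => (c`_(j * p + i * p ^ 2 + k))%R)) // mulnn.
apply/eq_in_map => n; rewrite mem_iota /= => n_lt.
rewrite /pt (modn_small kp) (divn_small kp) !add0n addn0 (@modn_small (n %/ p)).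
  by rewrite [X in X + k]addnC.
by rewrite ltn_divLR // mulnn.
Qed.

Lemma modn_sqr_carry n : n = n %/ p ^ 2 * p * p + n %% p ^ 2.
Proof. by rewrite -mulnA mulnn -divn_eq. Qed.

Lemma div_modp_inj n m : n < p ^ 2 -> m < p ^ 2 ->
  n = m %[mod p] -> n %/ p = m %/ p %[mod p] -> n = m.
Proof.
move=> n_lt m_lt nm.
rewrite !(@modn_small (_ %/ p)) ?ltn_divLR ?mulnn // => e.
by rewrite (divn_eq n p) (divn_eq m p) nm e.
Qed.

(** These are the hypotheses of [cycle_perm_nth] with period p^2: adding p^2 to k carries a multiple
    of p into y, where it vanishes modulo p. *)
Lemma pt_k_line x : [/\ forall n, pt x 0 (n %% p ^ 2) = pt x 0 n
  & forall n m, n < p ^ 2 -> m < p ^ 2 -> pt x 0 n = pt x 0 m -> n = m].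
Proof.
split=> [n|n m n_lt m_lt /pt_inj[_ nm /eqP]].
  by rewrite [in RHS](modn_sqr_carry n) pt_carry_k; apply: pt_mod_y; rewrite add0n modnMl mod0n.
by rewrite !add0n eqn_modDl => /eqP; apply: div_modp_inj.
Qed.

Lemma pt_x_line k : [/\ forall n, pt (n %% p ^ 2) 0 k = pt n 0 k
  & forall n m, n < p ^ 2 -> m < p ^ 2 -> pt n 0 k = pt m 0 k -> n = m].
Proof.
split=> [n|n m n_lt m_lt /pt_inj[nm _ /eqP]].
  by rewrite [in RHS](modn_sqr_carry n) pt_carry_x; apply: pt_mod_y; rewrite add0n modnMl mod0n.
by rewrite !add0n eqn_modDr => /eqP; apply: div_modp_inj.
Qed.

Lemma cycle_a_pt x y k : x < p -> cycle_a p c x (pt x y k) = pt x y k.+1.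
Proof.
move=> xp; have [d_mod d_inj] := pt_k_line x.
have ptE l : pt x y l = pt x 0 (y * p + l) by rewrite pt_carry_k.
by rewrite cycle_aE // !ptE addnS cycle_perm_nth ?expn_gt0 ?p_gt0.
Qed.

Lemma cycle_a_out m x y k : m < p -> x < p -> m != x ->
  cycle_a p c m (pt x y k) = pt x y k.
Proof.
move=> mp xp mx; rewrite cycle_aE // cycle_perm_out // => n /pt_inj[/eqP + _ _].
by rewrite !modn_small // eq_sym (negPf mx).
Qed.

Lemma perm_a_pt x y k : perm_a p c (pt x y k) = pt x y k.+1.
Proof.
(* Moving the carry of x into y leaves a true digit, which selects the only cycle that moves the
   point. *)
rewrite (divn_eq x p) !pt_carry_x.
have := ltn_pmod x p_gt0; move: (x %% p) (_ + _) => {}x {}y xp.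
rewrite /perm_a (prod_perm_single (i0 := Ordinal xp)) /= ?cycle_a_pt // => m mx.
  by rewrite cycle_a_out.
by rewrite cycle_a_out.
Qed.

Lemma cycle_b_pt x y k n : k < p -> (cycle_b p c k ^+ n)%g (pt x y k) = pt (x + n) y k.
Proof.
move=> kp; have [d_mod d_inj] := pt_x_line k.
elim: n => [|n IHn]; first by rewrite expg0 perm1 addn0.
have ptE l : pt l y k = pt (y * p + l) 0 k by rewrite pt_carry_x.
by rewrite expgSr permM IHn addnS cycle_bE // !ptE addnS cycle_perm_nth ?expn_gt0 ?p_gt0.
Qed.

Lemma cycle_b_out m x y k n : m < p -> k < p -> m != k ->
  (cycle_b p c m ^+ n)%g (pt x y k) = pt x y k.
Proof.
move=> mp kp mk; rewrite permX; apply: iter_fix.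
rewrite cycle_bE // cycle_perm_out // => i /pt_inj[_ /eqP + _].
by rewrite !modn_small // eq_sym (negPf mk).
Qed.

(** The exponent 1 + k p explains the shear: b_k advances x by one step, and the k p further steps
    carry k into y. *)
Lemma perm_b_pt x y k : perm_b p c (pt x y k) = pt x.+1 (y + k) k.
Proof.
have -> : pt x.+1 (y + k) k = pt x.+1 (y + k %/ p + k %% p) (k %% p).
  rewrite {2}(divn_eq k p) pt_carry_k; apply: pt_mod_y.
  by rewrite addnAC -modnDmr addnAC.
rewrite {1}(divn_eq k p) pt_carry_k.
have := ltn_pmod k p_gt0; move: (k %% p) (_ + _) => {}k {}y kp.
rewrite /perm_b (prod_perm_single (i0 := Ordinal kp)) /= ?cycle_b_pt // => [|m mk|m mk].
- by rewrite addnA addnC addn1 pt_carry_x.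
- by rewrite cycle_b_out.
- by rewrite cycle_b_out.
Qed.

(** * The elements of G in coordinates *)

Lemma elt_pt i j k x y l :
  elt p c i j k (pt x y l) = pt (x + j) (y + i + j * l) (l + k).
Proof.
have aX n x' y' l' : (perm_a p c ^+ n)%g (pt x' y' l') = pt x' y' (l' + n).
  elim: n => [|n IHn]; first by rewrite expg0 perm1 addn0.
  by rewrite expgSr permM IHn perm_a_pt addnS.
have bX n x' y' l' : (perm_b p c ^+ n)%g (pt x' y' l') = pt (x' + n) (y' + n * l') l'.
  elim: n => [|n IHn]; first by rewrite expg0 perm1 !addn0.
  by rewrite expgSr permM IHn perm_b_pt addnS mulSn [l' + _]addnC addnA.
(* The power of b acts first, so its shear sees the original l. Of its i p + j steps, the i p steps
   carry i into y, and their shear i p l vanishes modulo p. *)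
rewrite /elt /comp_perm permM bX aX addnCA pt_carry_x.
apply: pt_mod_y; rewrite mulnDl addnC !addnA -mulnA [p * l]mulnC mulnA.
by rewrite -addnA [i * l * p + _]addnC addnA addnC modnMDl [i + y]addnC.
Qed.

(** A Heisenberg-type law: the right factor has shifted the last coordinate by k' before the left
    one shears by j, hence the term j k'. Leaving the indices unbounded keeps carries out of it. *)
Lemma elt_comp i j k i' j' k' :
  comp_perm (elt p c i j k) (elt p c i' j' k') =
  elt p c (i + i' + j * k') (j + j') (k + k').
Proof.
apply: perm_ptP => x y l; rewrite permM !elt_pt.
rewrite -!addnA [j' + j]addnC [k' + k]addnC; congr pt.
by rewrite mulnDr mulnDl; lia.
Qed.

(** Carries of j and k feed i, just as those of x and k feed y in [pt]. With [elt_comp] this closes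
    the p^3 elements with digit indices under products. *)
Lemma elt_normal i j k :
  elt p c i j k = elt p c ((i + j %/ p + k %/ p) %% p) (j %% p) (k %% p).
Proof.
apply: perm_ptP => x y l; rewrite !elt_pt.
have carry n m : n + m = m %/ p * p + (n + m %% p) by rewrite addnCA -divn_eq.
rewrite (carry x j) (carry l k) pt_carry_x pt_carry_k; apply: pt_mod_y.
have -> : y + i + j * l + j %/ p + k %/ p = y + (i + j %/ p + k %/ p) + j * l by lia.
by rewrite -modnDmr -modnMml modnDmr [in RHS]addnAC modnDmr addnAC.
Qed.

(** The first and last coordinates of the image reveal j and k; once these agree, the middle one
    reveals i. *)
Lemma elt_semiregular z i j k i' j' k' :
  i < p -> j < p -> k < p -> i' < p -> j' < p -> k' < p ->
  elt p c i j k z = elt p c i' j' k' z -> [/\ i = i', j = j' & k = k'].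
Proof.
move=> ip jp kp ip' jp' kp'; have [x [y [l [_ _ _ ->]]]] := pt_surj z.
rewrite !elt_pt => /pt_inj[/eqP + /eqP + /eqP].
rewrite eqn_modDl (modn_small jp) (modn_small jp') => /eqP->.
rewrite eqn_modDl (modn_small kp) (modn_small kp') => /eqP->.
by rewrite !eqn_modDr eqn_modDl !modn_small // => /eqP->.
Qed.

(** * The indexing of the tuple, and doubling *)

Lemma idx_lt i j k : j < p -> k < p -> idx p i j k < p ^ 3.
Proof.
by move=> jp kp; rewrite /idx [_ * p + _]addnC digits_lt // ltn_pmod.
Qed.

Lemma nth_idx i j k : j < p -> k < p -> (c`_(idx p i j k))%R = pt j (i + j * k) k.
Proof.
move=> jp kp; rewrite /idx [_ * p + _]addnC -pt_small ?ltn_pmod //.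
by apply: pt_mod_y; rewrite modn_mod.
Qed.

Lemma modn_complement y n : exists2 i, i < p & y = i + n %[mod p].
Proof.
(* The product [n * p.-1] represents -n modulo p without truncated subtraction. *)
exists ((y + n * p.-1) %% p); first by rewrite ltn_pmod.
by rewrite modnDml -addnA -mulnSr prednK // addnC modnMDl.
Qed.

Lemma idx_surj n : n < p ^ 3 ->
  exists i j k, [/\ i < p, j < p, k < p & n = idx p i j k].
Proof.
move=> n_lt; have jp : n %/ p %/ p < p.
  by rewrite -divnMA ltn_divLR ?muln_gt0 ?p_gt0 // -!expnS.
pose j := n %/ p %/ p; pose k := n %% p.
have [i ip n_mid] := modn_complement (n %/ p) (j * k).
exists i, j, k; split; rewrite ?ltn_pmod // /idx -n_mid [_ + j * _]addnC.
by rewrite -mulnn mulnA -mulnDl -!divn_eq.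
Qed.

(** The element indexed by (j, y, k) has i = y - j k modulo p. It adds i + j k = y to the middle
    coordinate, so the shear cancels and every coordinate doubles. *)
Lemma elt_double_pt j y k : exists2 i, i < p & pt j y k = pt j (i + j * k) k /\
  elt p c i j k (pt j y k) = pt (2 * j) (2 * y) (2 * k).
Proof.
have [i ip y_e] := modn_complement y (j * k).
exists i => //; split; first exact: pt_mod_y.
rewrite elt_pt -addnA !addnn !mul2n; apply: pt_mod_y.
by rewrite -addnn -modnDmr -y_e modnDmr.
Qed.

Lemma double_pt_inj x y k x' y' k' : odd p ->
  x < p -> y < p -> k < p -> x' < p -> y' < p -> k' < p ->
  pt (2 * x) (2 * y) (2 * k) = pt (2 * x') (2 * y') (2 * k') ->
  [/\ x = x', y = y' & k = k'].
Proof.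
move=> p_odd xp yp kp xp' yp' kp'.
have dbl n m : n < p -> m < p -> 2 * n = 2 * m %[mod p] -> n = m.
  (* For odd p, (p + 1) / 2 is the inverse of 2 modulo p. *)
  have half r : r = p.+1./2 * (2 * r) %[mod p].
    by rewrite mulnA muln2 halfK /= p_odd /= subn0 mulSn addnC mulnC modnMDl.
  move=> np mp e; rewrite -(modn_small np) -(modn_small mp) half.
  by rewrite -modnMmr e modnMmr -half.
(* Once the outer digits are known to agree, so do the carries of their doubles, and these cancel in
   the middle congruence. *)
move=> /pt_inj[/dbl-> // /dbl-> // /eqP +].
by rewrite !eqn_modDr => /eqP/dbl->.
Qed.

End Coordinates.

(** * Companions from unique agreement, and the theorem *)

Lemma pp_tuple_comp (F : finFieldType) (beta : 'I_#|F| -> {perm F}) (eta : {perm F}) :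
  pp_tuple beta -> pp_tuple (fun t => comp_perm eta (beta t)).
Proof.
move/pp_tupleP => beta_inj; apply/pp_tupleP => x s t.
by rewrite !permM => /perm_inj/beta_inj.
Qed.

(** Since the entries form a group, beta_s beta_t^-1 is again some beta_r. Its unique agreement
    point with [eta] determines x_1, and then x_2 = beta_s(x_1). *)
Lemma companions_of_unique_agreement (F : finFieldType) (c : seq F)
    (beta : 'I_#|F| -> {perm F}) (G : {group {perm F}}) (eta : {perm F}) f g :
  perm_eq c (enum F) -> [set beta t | t : 'I_#|F|] = G :> {set _} ->
  (forall s, exists! z, beta s z = eta z) ->
  lpp_of_tuple c beta f -> lpp_of_tuple c (fun t => comp_perm eta (beta t)) g ->
  companions f g.
Proof.
move=> c_enum betaG solE [_ f_lpp _ fE] [_ g_lpp _ gE] u v.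
have enumE w : exists s : 'I_#|F|, w = c`_s.
  have w_c : w \in c by rewrite (perm_mem c_enum) mem_enum.
  have w_lt : (index w c < #|F|)%N by rewrite -(size_enumeration c_enum) index_mem.
  by exists (Ordinal w_lt); rewrite /= nth_index.
have [[s ->] [t ->]] := (enumE u, enumE v).
have [r r_e] : exists r, beta r = comp_perm (beta s) (beta t)^-1%g.
  have betaGP q : beta q \in G by rewrite -[_ \in G]/(_ \in (G : {set _})) -betaG imset_f.
  have : comp_perm (beta s) (beta t)^-1%g \in (G : {set _}) by rewrite groupM ?groupV.
  by rewrite -betaG => /imsetP[r _ ->]; exists r.
have fP x y : ev2 f x y = c`_s <-> y = beta s x.
  split=> [e|->]; last exact: fE.
  by apply: (bij_inj (f_lpp x).2); rewrite fE.
have gP x y : ev2 g x y = c`_t <-> y = eta (beta t x).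
  split=> [e|->]; last by rewrite -(gE t x) permM.
  by apply: (bij_inj (g_lpp x).2); rewrite e -[in RHS]permM gE.
have rE x : (beta r (beta t x) = eta (beta t x)) <-> (beta s x = eta (beta t x)).
  by rewrite r_e permM permK.
have [z [z_sol z_uniq]] := solE r; pose x := (beta t)^-1%g z.
have zE : z = beta t x by rewrite permKV.
exists (x, beta s x); split=> [|[x' y'] /= [/fP y'E /gP y'E']].
  by split=> /=; [apply/fP | apply/gP/rE; rewrite -zE].
suff -> : x = x' by rewrite y'E.
by apply: (@perm_inj _ (beta t)); rewrite -zE; apply/z_uniq/rE; rewrite -y'E.
Qed.

Theorem theorem3p5 (p : nat) (F : finFieldType) (c : seq F)
    (p_pr : prime p) (p_odd : odd p) (cardF : #|F| = (p ^ 3)%N)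
    (c_enum : perm_eq c (enum F))
    (beta : 'I_#|F| -> {perm F})
    (beta_eq : forall (i j k : 'I_p) (t : 'I_#|F|),
        t = idx p i j k :> nat -> beta t = elt p c i j k)
    (h : F -> F)
    (h_eq : forall i j k : 'I_p,
        h c`_(idx p i j k) = elt p c i j k c`_(idx p i j k)) :
  exists (f g : {mpoly F[2]}) (eta : {perm F}),
    [/\ unique (lpp_of_tuple c beta) f,
        perm_group_poly c f (group_G p c),
        eta =1 h,
        unique (lpp_of_tuple c (fun t => comp_perm eta (beta t))) g
      & companions f g].
Proof.
have p_gt0 := prime_gt0 p_pr.
have betaE (t : 'I_#|F|) : exists i j k, [/\ (i < p)%N, (j < p)%N & (k < p)%N] /\
    t = idx p i j k :> nat /\ beta t = elt p c i j k.
  have [|i [j [k [ip jp kp tE]]]] := @idx_surj p p_gt0 t; first by rewrite -cardF.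
  exists i, j, k; split=> //; split=> //.
  exact: (beta_eq (Ordinal ip) (Ordinal jp) (Ordinal kp)).
have eltE i j k : (i < p)%N -> (j < p)%N -> (k < p)%N ->
    exists2 t : 'I_#|F|, t = idx p i j k :> nat & beta t = elt p c i j k.
  move=> ip jp kp; have t_lt : (idx p i j k < #|F|)%N by rewrite cardF idx_lt.
  exists (Ordinal t_lt) => //.
  exact: (beta_eq (Ordinal ip) (Ordinal jp) (Ordinal kp)).
have beta_inj x s t : beta s x = beta t x -> s = t.
  have [i [j [k [[ip jp kp] [sE ->]]]]] := betaE s.
  have [i' [j' [k' [[ip' jp' kp'] [tE ->]]]]] := betaE t.
  move=> e; have [ii jj kk] := elt_semiregular p_gt0 cardF c_enum ip jp kp ip' jp' kp' e.
  by apply: ord_inj; rewrite sE tE ii jj kk.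
have betaP : pp_tuple beta by apply/pp_tupleP.
have elt_in i j k : elt p c i j k \in [set beta t | t : 'I_#|F|].
  rewrite (elt_normal p_gt0 cardF c_enum).
  have p_mod n : (n %% p < p)%N by rewrite ltn_pmod.
  have [t _ <-] := eltE _ _ _ (p_mod (i + j %/ p + k %/ p)%N) (p_mod j) (p_mod k).
  exact: imset_f.
have h_pt x y k : (x < p)%N -> (k < p)%N ->
    h (pt p c x y k) = pt p c (2 * x) (2 * y) (2 * k).
  move=> xp kp; have [i ip [ptE]] := elt_double_pt p_gt0 cardF c_enum x y k.
  rewrite ptE -(nth_idx c p_gt0) // => <-.
  exact: (h_eq (Ordinal ip) (Ordinal xp) (Ordinal kp)).
have h_inj : injective h.
  move=> z z'.
  have [x [y [k [xp yp kp ->]]]] := pt_surj p_gt0 cardF c_enum z.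
  have [x' [y' [k' [xp' yp' kp' ->]]]] := pt_surj p_gt0 cardF c_enum z'.
  rewrite !h_pt // => e.
  by have [-> -> ->] := double_pt_inj p_gt0 cardF c_enum p_odd xp yp kp xp' yp' kp' e.
have betaG : [set beta t | t : 'I_#|F|] = group_G p c :> {set _}.
  apply/eqP; rewrite eqEsubset; apply/andP; split.
    apply/subsetP => _ /imsetP[t _ ->].
    have [i [j [k [_ [_ ->]]]]] := betaE t.
    by rewrite groupM ?groupX ?mem_gen // !inE eqxx ?orbT.
  have S_group : group_set [set beta t | t : 'I_#|F|].
    apply/group_setP; split=> [|_ _ /imsetP[s _ ->] /imsetP[t _ ->]].
      by have := elt_in 0%N 0%N 0%N; rewrite /elt /comp_perm !expg0 mulg1.
    have [i [j [k [_ [_ ->]]]]] := betaE s.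
    have [i' [j' [k' [_ [_ ->]]]]] := betaE t.
    (* The product of the library composes left to right, so the two factors trade places under
       [comp_perm]. *)
    rewrite -[X in X \in _]/(comp_perm (elt p c i' j' k') (elt p c i j k)).
    by rewrite (elt_comp p_gt0 cardF c_enum).
  rewrite (gen_subG _ (Group S_group)); apply/subsetP => s; rewrite !inE.
  case/orP=> /eqP->.
    by have := elt_in 0%N 0%N 1%N; rewrite /elt /comp_perm expg0 mul1g expg1.
  by have := elt_in 0%N 1%N 0%N; rewrite /elt /comp_perm expg0 mulg1 expg1.
pose eta := perm h_inj.
have eta_sol t : exists! z, beta t z = eta z.
  have [i [j [k [[ip jp kp] [tE bE]]]]] := betaE t.
  (* By the definition of h, beta_t agrees with it at c_t. Any other agreement point is some c_s,
     where h takes the value beta_s(c_s), and [beta_inj] forces s = t. *)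
  exists c`_t; split=> [|z].
    by rewrite permE bE tE -(h_eq (Ordinal ip) (Ordinal jp) (Ordinal kp)).
  have [x [y [l [xp _ lp zE]]]] := pt_surj p_gt0 cardF c_enum z.
  have [i' ip' [ptE _]] := elt_double_pt p_gt0 cardF c_enum x y l.
  have [s sE bsE] := eltE _ _ _ ip' xp lp.
  have zs : z = c`_s by rewrite zE ptE -(nth_idx c p_gt0) // sE.
  have -> : eta z = beta s z.
    by rewrite permE zs bsE sE (h_eq (Ordinal ip') (Ordinal xp) (Ordinal lp)).
  by move/beta_inj->.
have [f f_uniq] := lpp_of_tuple_exists c_enum betaP.
have [g g_uniq] := lpp_of_tuple_exists c_enum (pp_tuple_comp eta betaP).
exists f, g, eta; split=> //.
- by exists beta => //; case: f_uniq.
- by move=> z; rewrite permE.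
- exact: (companions_of_unique_agreement c_enum betaG eta_sol f_uniq.1 g_uniq.1).
Qed.
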